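(* Assume $2^{\omega}=\omega_1$ and $2^{\omega_1}=\omega_2$. Let $I=[0,1]$ and let $I^{\omega_2}$ carry the usual (Tychonoff) product topology, a compact space of weight $\omega_2$. Then the box product $\square (I^{\omega_2})^{\omega}$ is not a $D$-space.
   Context: A neighbornet on a space $(X,\tau)$ is a map $U:X\to\tau$ with $x\in U(x)$ for all $x\in X$. $X$ is a $D$-space if for every neighbornet $U$ on $X$ there is a closed discrete $D\subseteq X$ with $\bigcup_{x\in D}U(x)=X$. For a space $X$, the box product $\square X^\omega$ is the set $X^\omega$ with the topology generated by all sets $\prod_{n\in\omega} U_n$ with every $U_n$ open in $X$. *)

(* Defs.v *)
From HB Require Import structures.
From mathcomp Require Import all_boot all_order all_algebra.
From mathcomp Require Import all_classical all_reals all_analysis.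
Import numFieldNormedType.Exports.

Set Implicit Arguments.
Unset Strict Implicit.
Unset Printing Implicit Defensive.

Import Order.TTheory GRing.Theory Num.Theory.

Local Open Scope classical_set_scope.
Local Open Scope card_scope.
Local Open Scope ring_scope.

(* |T| is the successor cardinal of |S|: it is strictly above |S|, and no
   cardinal lies strictly between. A cardinal below |T| is the cardinal of a
   subset of T, so quantifying over [set T] avoids quantifying over a universe. *)
Definition succ_card (S T : Type) : Prop :=
  [/\ [set: S] #<= [set: T],
      ~ ([set: T] #<= [set: S]) &
      forall A : set T, A #<= [set: S] \/ [set: T] #<= A].

Definition neighbornet (X : topologicalType) (U : X -> set X) : Prop :=
  forall x, open (U x) /\ U x x.

Definition discrete_subset (X : topologicalType) (D : set X) : Prop :=
  forall x, D x -> isolated D x.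

Definition D_space (X : topologicalType) : Prop :=
  forall U : X -> set X, neighbornet U ->
    exists D : set X,
      [/\ closed D, discrete_subset D & \bigcup_(x in D) U x = [set: X]].

(* An alias of [nat -> X], so that the box topology does not clash with the
   product topology that the library puts on function types. *)
Definition box_product (X : Type) : Type := nat -> X.

Section BoxTopology.
Variable X : topologicalType.

Definition open_family : set (nat -> set X) := [set U | forall n, open (U n)].

Definition box (U : nat -> set X) : set (box_product X) :=
  [set f | forall n, U n (f n)].

Lemma box_cover : \bigcup_(U in open_family) box U = setT.
Proof.
by apply/seteqP; split=> // f _; exists (fun=> setT) => // n; exact: openT.
Qed.

Lemma box_join (U V : nat -> set X) (f : box_product X) :
  open_family U -> open_family V -> box U f -> box V f ->
  exists W, [/\ open_family W, box W f & box W `<=` box U `&` box V].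
Proof.
move=> oU oV Uf Vf; exists (fun n => U n `&` V n); split.
- by move=> n; exact: openI (oU n) (oV n).
- by move=> n; split; [exact: Uf|exact: Vf].
- by move=> g Wg; split=> n; case: (Wg n).
Qed.

HB.instance Definition _ := Choice.copy (box_product X) (nat -> X).
HB.instance Definition _ :=
  isBaseTopological.Build (box_product X) box_cover box_join.

End BoxTopology.

(* Main.v *)
Require Import Defs.
From mathcomp Require Import all_boot all_order all_algebra.
From mathcomp Require Import all_classical all_reals all_analysis.
From mathcomp Require wochoice.
Import numFieldNormedType.Exports.
Import Order.TTheory GRing.Theory Num.Theory.

Local Open Scope classical_set_scope.
Local Open Scope card_scope.
Local Open Scope ring_scope.

(** The box product contains a closed copy of a space that fails to be a
    D-space because it is right separated while its discrete subsets are small.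
    The space is a version, one cardinal up, of van Douwen's refinement of the
    real line.

    Give 2^omega1 the topology in which the points agreeing with r below a
    countable ordinal i form the i-th neighbourhood of r.  It has omega2 points,
    and a weight of only omega1, so each set E of points contains a subset of
    size omega1 approximating every point of E.  There are omega2 subsets of size
    at most omega1; enumerate the points as r_a and these subsets as A_n, for a
    and n in omega2.  By recursion on b, refine the topology at r_b: the new
    neighbourhood K_b (in_cone) consists of r_b and of parts of the
    neighbourhoods K_s of points s < b which converge to r_b and which include
    members of A_n arbitrarily close to r_b for every n < b such that r_b is a
    limit of earlier members of A_n.  Only countably many of the s differ from
    r_b below a given countable ordinal, so every K_b stays clopen
    (in_cone_locally_constant).
    The initial segments are then open, while an unbounded set E is never
    discrete: for A_n a small subset approximating E, any a in E
    beyond n and beyond A_n is a limit of A_n (line_accumulation).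

    To embed this space, attach to a point a and an index b the coordinate
    line_coord a b, which records one bit of r_a, whether a is in K_b and, if it
    is not, the first place where r_a and r_b differ.  Neighbourhoods of points
    given by countably many of these coordinates are the neighbourhoods of the
    refined topology, and the set of coordinate functions is closed under
    approximation on countable index sets (line_closed): the bits of a limit v
    form some r_a as 2^omega1 is exhausted, and a recorded first difference with
    r_a would contradict agreement with r_a, hence v lies in K_a and equals
    the coordinate function of a.

    By CH the coordinates are coded as infinite bit sequences in which every bit
    recurs infinitely often.  Put the n-th bit of the code of line_coord a b at
    place b of the n-th factor of the box product.  An open box restricts finitely
    many places in each factor, so it controls countably many places; conversely
    the k-th of countably many places can be restricted in all factors from the
    k-th on, which determines the coordinate there.  So this is a closed embedding
    for the countable-support topology (points_closed).  The neighbornet given by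
    the sets K_a on the image and its complement elsewhere has no discrete kernel
    (box_product_not_D). *)

Set Implicit Arguments.
Unset Strict Implicit.

(** * Cardinals and well-orders *)

Lemma card_le_cover (S T : Type) (A : set T) (t0 : T) :
  A #<= [set: S] -> exists f : S -> T, A `<=` range f.
Proof.
elim/Ppointed: T => T in A t0 *; first by case: (no t0).
by move=> /pcard_surjP[f]; exists f.
Qed.

Lemma countable_setU (T : Type) (A B : set T) :
  countable A -> countable B -> countable (A `|` B).
Proof.
move=> cA cB; have cAB : countable (\bigcup_(b in [set: bool]) if b then A else B).
  by apply: bigcup_countable => // -[].
apply: sub_countable cAB; apply: subset_card_le => x [Ax|Bx].
- by exists true.
- by exists false.
Qed.

(** Well-orders whose proper initial segments have size at most that of [S];
    for [S] and [T] successive cardinals these are the initial ordinals of [T]. *)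
Definition initial_order (S T : Type) (lt : T -> T -> Prop) : Prop :=
  [/\ well_founded lt,
      forall x y z, lt x y -> lt y z -> lt x z,
      forall x y, [\/ lt x y, x = y | lt y x] &
      forall x, [set y | lt y x] #<= [set: S]].

Lemma initial_order_irr (S T : Type) (lt : T -> T -> Prop) :
  initial_order S lt -> forall x, ~ lt x x.
Proof.
by move=> [wf _ _ _] x; elim: (wf x) => {}x _ IH xx; exact: (IH x xx xx).
Qed.

Lemma well_order_lt (T : Type) : exists lt : T -> T -> Prop,
  [/\ well_founded lt,
      forall x y z, lt x y -> lt y z -> lt x z &
      forall x y, [\/ lt x y, x = y | lt y x]].
Proof.
have [R Rwo] := wochoice.well_ordering_principle {classic T}.
have Rmin (A : set T) x : A x -> exists z, A z /\ forall y, A y -> R z y.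
  move=> Ax.
  have [|z [[Az zA] _]] := Rwo [pred y | `[< A y >]].
    by exists x; apply/asboolP.
  exists z; split; first by move/asboolP: Az.
  by move=> y Ay; apply: zA; apply/asboolP.
have Rwc : wochoice.wo_chain R predT by move=> A _; exact: Rwo.
have Rtot x y : R x y \/ R y x.
  by apply/orP; exact: (wochoice.wo_chainW Rwc).
have Ranti x y : R x y -> R y x -> x = y.
  by move=> xy yx; apply: (wochoice.wo_chain_antisymmetric Rwc) => //; rewrite xy.
exists (fun x y => R x y /\ x <> y); split.
- move=> x; apply: contrapT => nAx.
  have [z [nAz zmin]] := Rmin [set x | ~ Acc (fun x y => R x y /\ x <> y) x] x nAx.
  apply: nAz; constructor => y [Ryz yz]; apply: contrapT => nAy.
  by apply: yz; apply: Ranti => //; exact: zmin.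
- move=> x y z [xy nxy] [yz nyz].
  have xz : x <> z by move=> e; apply: nxy; apply: Ranti => //; rewrite e.
  split=> //; have [w [ws wmin]] := Rmin [set x; y; z] x (or_introl (or_introl erefl)).
  have := wmin z (or_intror erefl); have := wmin x (or_introl (or_introl erefl)).
  have := wmin y (or_introl (or_intror erefl)).
  by case: ws => [[->|->]|->] // ? ? ?; [case: nxy|case: nyz]; apply: Ranti.
- move=> x y; have [->|xy] := pselect (x = y); first by constructor 2.
  by case: (Rtot x y) => ?; [constructor 1|constructor 3; split=> // /esym].
Qed.

(** A well-order of [T] having a segment larger than [S] has a least such
    segment; it is as large as [T], and the order pulled back along an injection of [T] into it
    has segments of size at most [S]. *)
Lemma succ_card_initial_order (S T : Type) :
  succ_card S T -> exists lt : T -> T -> Prop, initial_order S lt.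
Proof.
move=> [_ _ ST]; have [lt [wf tr tot]] := well_order_lt T.
have [small|/existsNP[x nx]] := pselect (forall x, [set y | lt y x] #<= [set: S]).
  by exists lt.
have {x nx}[x [nx xmin]] : exists x, ~ ([set y | lt y x] #<= [set: S]) /\
    forall y, lt y x -> [set z | lt z y] #<= [set: S].
  move: nx; elim: (wf x) => {}x _ IH nx.
  have [|/existsNP[y /not_implyP[yx ny]]] :=
    pselect (forall y, lt y x -> [set z | lt z y] #<= [set: S]).
    by exists x.
  exact: (IH y yx ny).
have [//|Tx] := ST [set y | lt y x].
have [f finj fx] : exists2 f : T -> T, injective f & forall t, lt (f t) x.
  have x0 : T := x.
  elim/Ppointed: T => T in lt wf tr tot x nx xmin ST Tx x0 *.
    by case: (no x0).
  have /pcard_leP/injfunPex[f fx finj] := Tx.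
  exists f => [a b|t]; last exact: fx.
  by apply: finj; rewrite inE.
exists (fun a b => lt (f a) (f b)); split.
- move=> a; have [b ab] : exists b, b = f a by exists (f a).
  elim: (wf b) a ab => {}b _ IH a ab; constructor => c ca.
  by apply: (IH (f c)) => //; rewrite ab.
- by move=> a b c; exact: tr.
- move=> a b; case: (tot (f a) (f b)) => h; [by constructor 1| |by constructor 3].
  by constructor 2; apply: finj.
- move=> a; apply: card_le_trans (xmin (f a) (fx a)).
  elim/Ppointed: T => T in lt wf tr tot x nx xmin ST Tx f finj fx a *.
    by case: (no a).
  apply/pcard_leP/injfunPex; exists f => //.
  by move=> u v _ _; apply: finj.
Qed.

(** Regularity of successor cardinals: if [f] were cofinal, [T] would be a union
    of [S] many initial segments and their end points.  The surjection [p] indexes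
    that union, [None] standing for the end point of a segment. *)
Lemma succ_card_bounded (S T : Type) (lt : T -> T -> Prop)
    (p : S -> S * option S) (f : S -> T) :
  succ_card S T -> initial_order S lt -> (forall z, exists s, p s = z) ->
  exists t, forall s, lt (f s) t.
Proof.
move=> [_ nTS _] [wf tr tot small] psurj; apply: contrapT => nb; apply: nTS.
have ub t : exists s, t = f s \/ lt t (f s).
  apply: contrapT => h; apply: nb; exists t => s.
  by case: (tot (f s) t) => // ts; exfalso; apply: h; exists s; [left|right].
have [g gP] := choice (fun x => card_le_cover x (small x)).
pose h u := let: (s, o) := p u in if o is Some v then g (f s) v else f s.
suff -> : [set: T] = range h by exact: card_image_le.
apply/seteqP; split=> // t _; have [s [->|ts]] := ub t.
  by have [u pu] := psurj (s, None); exists u => //; rewrite /h pu.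
have [v _ <-] := gP _ _ ts.
by have [u pu] := psurj (s, Some v); exists u => //; rewrite /h pu.
Qed.

(** * The refined topology on 2^omega1 *)

Section VanDouwenLine.
(** [W1] and [W2] stand for omega1 and omega2, [r] lists 2^W1 by [W2] and [fam]
    lists the families A_n; [seg b] lists the predecessors of [b], and [diff a b]
    is the first place where [r a] and [r b] differ.  All choices are parameters
    subject to a specification, so that only the existence statement deduced from
    this section involves cardinal arithmetic. *)
Variables (W1 W2 : Type) (lt1 : W1 -> W1 -> Prop) (lt2 : W2 -> W2 -> Prop).
Hypothesis ord1 : initial_order nat lt1.
Hypothesis ord2 : initial_order W1 lt2.
Hypothesis bounded1 : forall f : nat -> W1, exists i, forall k, lt1 (f k) i.
Hypothesis bounded2 : forall f : W1 -> W2, exists b, forall i, lt2 (f i) b.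

Variable r : W2 -> W1 -> bool.
Hypothesis r_surj : forall x, exists a, r a = x.

Variable fam : W2 -> W1 -> W2.
Hypothesis fam_surj : forall A, exists n, fam n = A.

Variable q : W1 -> W1 * (nat -> bool).
Hypothesis q_surj : forall z, exists i, q i = z.

Variables (pr : W2 -> W1) (sec : W1 -> W2).
Hypothesis secK : cancel sec pr.

Definition agree (a b : W2) (i : W1) := forall j, lt1 j i -> r a j = r b j.

Variable diff : W2 -> W2 -> W1.
Hypothesis diffP : forall a b, a <> b ->
  r a (diff a b) <> r b (diff a b) /\ agree a b (diff a b).

Variable seg : W2 -> W1 -> W2.
Hypothesis segP : forall b, [set a | lt2 a b] `<=` range (seg b).

(** The points [s < b] of the [n]-th small set that are [i]-close to [b]. *)
Definition candidate (b n : W2) (i : W1) : set W2 :=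
  [set s | range (fam n) s /\ lt2 s b /\ agree s b i].

Variable pick : W2 -> W2 -> W1 -> W2.
Hypothesis pickP : forall b n i,
  candidate b n i !=set0 -> candidate b n i (pick b n i).

(** The points chosen to converge to [b]: for each [n < b], presented as
    [seg b k], one candidate at every level [i >= k].  The restriction to
    [i >= k] leaves only countably many choices at a bounded level, and thus makes
    [countable_approx] true. *)
Definition approx (b s : W2) : Prop := exists k i,
  [/\ ~ lt1 i k, candidate b (seg b k) i s & s = pick b (seg b k) i].

(** [in_cone a b] says that [a] lies in the neighbourhood K_b.  Being an inductive
    predicate it needs no recursion on [b]; the recursion is implicit in
    [approx_lt].  The condition on [diff] keeps the part of K_s put into K_b at
    the same distance from [b] as [s] is. *)
Inductive in_cone (a : W2) : W2 -> Prop :=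
| cone_refl : in_cone a a
| cone_step b s : approx b s -> in_cone a s -> diff a b = diff s b -> in_cone a b.

Let irr1 := initial_order_irr ord1.
Let irr2 := initial_order_irr ord2.

Lemma le_lt_trans1 i j k : ~ lt1 j i -> lt1 j k -> lt1 i k.
Proof.
case: ord1 => _ tr tot _ nji jk.
by case: (tot i j) => [ij|->|/nji//] //; exact: tr ij jk.
Qed.

Lemma countable_segment i : countable [set j | lt1 j i].
Proof. by case: ord1 => _ _ _; exact. Qed.

Lemma countable_bounded (i0 : W1) (A : set W1) :
  countable A -> exists i, forall j, A j -> lt1 j i.
Proof.
move=> /(card_le_cover i0)[f Af]; have [i fi] := bounded1 f.
by exists i => j /Af[k _ <-].
Qed.

Lemma agreeW a b i j : lt1 j i -> agree a b i -> agree a b j.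
Proof. by case: ord1 => _ tr _ _ ji ab k kj; apply: ab; exact: tr kj ji. Qed.

(** The metric given by [diff] is non-archimedean. *)
Lemma diff_agree a b c i :
  a <> b -> agree c a i -> lt1 (diff a b) i -> c <> b /\ diff c b = diff a b.
Proof.
case: ord1 => _ tr tot _ ab ca di; have [nab eab] := diffP ab.
have cb : c <> b by move=> e; apply: nab; rewrite -(ca _ di) e.
split=> //; have [ncb ecb] := diffP cb.
case: (tot (diff c b) (diff a b)) => // h.
- by exfalso; apply: ncb; rewrite (ca _ (tr _ _ _ h di)) eab.
- by exfalso; apply: nab; rewrite -(ca _ di) ecb.
Qed.

Lemma approx_lt b s : approx b s -> lt2 s b.
Proof. by move=> [k [i [_ [_ []]]]]. Qed.

Lemma in_cone_le a b : in_cone a b -> a = b \/ lt2 a b.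
Proof.
case: ord2 => _ tr _ _.
elim=> {b} [|b s /approx_lt sb _ [->|as_] _]; [by left|by right|right].
exact: tr as_ sb.
Qed.

Lemma in_cone_inv a b : in_cone a b ->
  a = b \/ exists s, [/\ approx b s, in_cone a s & diff a b = diff s b].
Proof. by case=> {b} [|b s bs as_ ds]; [left|right; exists s]. Qed.

Lemma countable_approx b i : countable [set s | approx b s /\ lt1 (diff s b) i].
Proof.
have cseg := countable_segment i.
apply: sub_countable (countableX cseg cseg).
apply: card_le_trans (card_image_le (fun z => pick b (seg b z.1) z.2) _).
apply: subset_card_le => s [[k [j [kj [_ [sb agj]] sE]]] si].
have nsb : s <> b by move=> e; apply: (irr2 (x := b)); rewrite -{1}e.
have ji : lt1 j i.
  apply: le_lt_trans1 si => h; have [nd _] := diffP nsb.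
  exact: (nd (agj _ h)).
by exists (k, j); rewrite -?sE //; split=> //=; exact: le_lt_trans1 kj ji.
Qed.

(** K_b is clopen.  A point of K_a close enough to [a] is at the same distance
    from [b] as [a] is, so its membership in K_b is decided by the K_s for the
    countably many approximants [s < b] at that distance; by induction,
    membership in each of these K_s is constant on a neighbourhood of [a]. *)
Lemma in_cone_locally_constant a b : exists i, forall c,
  in_cone c a -> agree c a i -> (in_cone c b <-> in_cone a b).
Proof.
case: ord2 => wf _ _ _; elim: (wf b) => {}b _ IH.
have [<-|ab] := pselect (a = b).
  by exists (pr b) => c ca _; split=> // _; exact: cone_refl.
have ex s : exists i, lt2 s b -> forall c,
    in_cone c a -> agree c a i -> (in_cone c s <-> in_cone a s).
  have [/IH[i iP]|nsb] := pselect (lt2 s b); first by exists i.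
  by exists (pr b).
have [F FP] := choice ex.
have [d dP] := bounded1 (fun=> diff a b); have {}dP := dP 0.
have [i iP] := countable_bounded (pr a) (sub_countable (card_image_le F _)
  (countable_approx b d)).
have [m mP] := bounded1 (fun n => if n is 0 then i else d).
exists m => c ca cam.
have cad : agree c a d by apply: agreeW cam; exact: mP 1.
have cai : agree c a i by apply: agreeW cam; exact: mP 0.
have [cb dcb] := diff_agree ab cad dP.
have cone_s s : approx b s -> diff s b = diff a b -> in_cone c s <-> in_cone a s.
  move=> bs ds; apply: FP => //; first exact: approx_lt.
  by apply: agreeW cai; apply: iP; exists s => //; split=> //; rewrite ds.
split.
- case/in_cone_inv => [//|[s [bs cs ds]]]; rewrite dcb in ds.
  have [cs_as _] := cone_s s bs (esym ds).
  exact: cone_step bs (cs_as cs) ds.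
- case/in_cone_inv => [//|[s [bs as_ ds]]].
  have [_ as_cs] := cone_s s bs (esym ds).
  by apply: cone_step bs (as_cs as_) _; rewrite dcb.
Qed.

(** The coordinate [b] of the point [a].  The bits of [r a] are spread over the
    coordinates by the surjection [pr].  Recording [diff a b] outside K_b is what
    makes the set of coordinate functions closed: it witnesses that [a] stays
    away from [b]. *)
Definition line_coord (a b : W2) : bool * option W1 :=
  (r a (pr b), if `[< in_cone a b >] then None else Some (diff a b)).

Lemma line_coord_locally_constant a b : exists i, forall c,
  in_cone c a -> agree c a i -> line_coord c b = line_coord a b.
Proof.
have [i iP] := in_cone_locally_constant a b.
have [m mP] := bounded1
  (fun n => match n with 0 => i | 1 => pr b | _ => diff a b end).
exists m => c ca cam; congr pair; first exact: cam (mP 1).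
have nn := iP c ca (agreeW (mP 0) cam).
case: asboolP => [/nn h|h]; case: asboolP => // nab; first by exfalso; apply/h/nn.
congr Some; apply: (proj2 (diff_agree _ cam (mP 2))) => e.
by apply: nab; rewrite e; exact: cone_refl.
Qed.

(** The single coordinate [b] isolates [b] from all later points, since K_b
    contains no later point. *)
Lemma line_coord_diag a b : line_coord a b = line_coord b b -> ~ lt2 b a.
Proof.
case: ord2 => _ tr _ _ [_]; have -> : `[< in_cone b b >] = true.
  by apply/asboolP; exact: cone_refl.
case: asboolP => // /in_cone_le[->|ab] _ ba; first exact: irr2 ba.
exact: irr2 (tr _ _ _ ab ba).
Qed.

(** The bits of [v] are those of [r a] for some [a].  If [v a] recorded a first
    difference [d], a point approximating [v] at [a] and at the bits up to [d]
    would both differ from [a] at [d] and agree there.  So [v] is approximated by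
    points of K_a converging to [a]. *)
Lemma line_closed (v : W2 -> bool * option W1) :
  (forall B, countable B ->
     exists c, forall b, B b -> line_coord c b = v b) ->
  exists a, forall b, line_coord a b = v b.
Proof.
move=> vP; have [a ra] := r_surj (fun i => (v (sec i)).1).
have vr c i : line_coord c (sec i) = v (sec i) -> r c i = r a i.
  by move=> h; rewrite ra -h /= secK.
have cB i A : countable A -> countable (A `|` sec @` [set j | lt1 j i]).
  move=> cA; apply: countable_setU => //.
  exact: sub_countable (card_image_le _ _) (countable_segment i).
have va : (v a).2 = None.
  (* The place [d] itself has to be among the bits tested, hence a bound above it. *)
  case E: (v a).2 => [d|//]; have [m mP] := bounded1 (fun=> d).
  have [c cP] := vP _ (cB m [set a] (countable1 a)).
  have := congr1 snd (cP a (or_introl erefl)); rewrite E /=.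
  case: asboolP => // nca [dca].
  have ca : c <> a by move=> e; apply: nca; rewrite e; exact: cone_refl.
  have [nd _] := diffP ca; exfalso; apply: nd; rewrite dca; apply: vr.
  by apply: cP; right; exists d => //; exact: mP 0.
exists a => b; have [i iP] := line_coord_locally_constant a b.
have [c cP] := vP _ (cB i [set a; b] (countable_setU (countable1 a) (countable1 b))).
rewrite -(cP b (or_introl (or_intror erefl))); apply/esym/iP; last first.
  by move=> j ji; apply: vr; apply: cP; right; exists j.
have := congr1 snd (cP a (or_introl (or_introl erefl))); rewrite va /=.
by case: asboolP.
Qed.

(** An unbounded [E] contains a small set [fam n] approximating all its members,
    namely one member of [E] for each node of the binary tree passed by a member.
    Any [a] in [E] beyond [n] and beyond that set is a limit of members of the set,
    as [approx a] contains some at arbitrarily high levels. *)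
Lemma line_accumulation (b0 : W2) (E : set W2) :
  (forall b, exists2 a, E a & ~ lt2 a b) ->
  exists2 a, E a & forall B, countable B ->
    exists c, [/\ E c, lt2 c a & forall b, B b -> line_coord c b = line_coord a b].
Proof.
case: (ord2) => _ tr2 tot2 _; move=> Eunb; have [e0 Ee0 _] := Eunb b0.
have [s sP] := choice (fun i => card_le_cover (pr b0) (countable_segment i)).
have ex (z : W1 * (nat -> bool)) : exists h, E h /\
    forall e, E e -> (forall k, r e (s z.1 k) = z.2 k) -> agree h e z.1.
  case: z => i x; have [[h [Eh hx]]|nh] :=
    pselect (exists h, E h /\ forall k, r h (s i k) = x k).
    by exists h; split=> // e _ ex j /(sP i)[k _ <-]; rewrite hx ex.
  by exists e0; split=> // e Ee ex; exfalso; apply: nh; exists e.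
(* [g (i, x)] passes the node [x] at level [i], if any member of [E] does;
   [s i] enumerates the places below [i]. *)
have [g gP] := choice ex.
have [n fn] := fam_surj (g \o q).
have [t tP] := bounded2 (g \o q).
have [u uP] := bounded2 (fun=> n).
(* A point above both [t] and [u]: the range of a map taking these two values. *)
have [t' tt'] := bounded2 (fun i => if (q i).2 0 then t else u).
have tlt : lt2 t t'.
  by have [i qi] := q_surj (pr b0, fun=> true); have := tt' i; rewrite qi.
have ult : lt2 u t'.
  by have [i qi] := q_surj (pr b0, fun=> false); have := tt' i; rewrite qi.
have [a Ea nat'] := Eunb t'.
have above w : lt2 w t' -> lt2 w a.
  by case: (tot2 a t') => // [->//|ta wt]; exact: tr2 wt ta.
exists a => // B cB.
have na : lt2 n a by apply: tr2 (above _ ult); exact: uP (pr b0).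
have [k _ kn] := segP na.
have [F FP] := choice (line_coord_locally_constant a).
have [i iP] := countable_bounded (pr a) (sub_countable (card_image_le F _) cB).
have [m mP] := bounded1 (fun n => if n is 0 then i else k).
have cand : candidate a n m !=set0.
  exists (g (m, fun k => r a (s m k))); split; last split.
  - rewrite fn; have [w qw] := q_surj (m, fun k => r a (s m k)).
    by exists w => //=; rewrite qw.
  - have [w qw] := q_surj (m, fun k => r a (s m k)).
    by have := tP w; rewrite /= qw => h; apply: tr2 h (above _ tlt).
  - by have [_] := gP (m, fun k => r a (s m k)); apply.
have [fc [ca cam]] := pickP cand; set c := pick a n m in fc ca cam *.
have nca : in_cone c a.
  apply: (cone_step (s := c)) => //; last exact: cone_refl.
  exists k, m; rewrite kn; split=> //.
  case: ord1 => _ tr1 _ _ mk; exact: (irr1 (tr1 _ _ _ mk (mP 1))).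
exists c; split=> //.
- by move: fc; rewrite fn => -[w _ <-]; exact: (gP (q w)).1.
- move=> b Bb; apply: FP => //; apply: agreeW (agreeW (mP 0) cam).
  by apply: iP; exists b.
Qed.
End VanDouwenLine.

(** * Closed copies in box products *)

Section PointwiseProduct.
Variables (W : Type) (K : topologicalType).

(** The sets determined around [x] by countably many coordinates form a filter
    converging to [x].  Supports are only kept countable because they are united
    over the factors of a box. *)
Lemma ptws_open_countable (U : set {ptws W -> K}) (x : {ptws W -> K}) :
  open U -> U x ->
  exists B : set W,
    countable B /\ forall y, (forall b, B b -> y b = x b) -> U y.
Proof.
move=> oU Ux.
pose F : set_system {ptws W -> K} := [set A | exists B : set W,
  countable B /\ forall y, (forall b, B b -> y b = x b) -> A y].
have FF : Filter F.
  split.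
  - by exists set0.
  - move=> A A' [B [cB BA]] [B' [cB' BA']]; exists (B `|` B').
    split; first exact: countable_setU.
    by move=> y yx; split; [apply: BA|apply: BA'] => b Bb; apply: yx; [left|right].
  - by move=> A A' AA' [B [cB BA]]; exists B; split=> // y /BA /AA'.
have Fx : F --> x.
  apply/cvg_sup => i A [_ [[V oV <-] Vx] VA].
  by exists [set i]; split=> // y yx; apply: VA; rewrite /= yx.
by apply: Fx; exact: open_nbhs_nbhs.
Qed.

Lemma ptws_neq_open (b : W) (k : K) :
  accessible_space K -> open [set x : {ptws W -> K} | x b <> k].
Proof.
move=> T1.
have ck : open (~` [set k]) by apply: closed_openC; exact: accessible_closed_set1.
suff cb : continuous (fun x : {ptws W -> K} => x b).
  exact: open_comp (fun x _ => cb x) ck.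
move=> x A; rewrite nbhsE => -[V [oV Vx] VA].
have /cvg_sup/(_ b) : nbhs x --> x by exact: cvg_id.
apply; exists ((fun y : W -> K => y b) @^-1` V); split=> // [|y /VA//].
by exists V.
Qed.

End PointwiseProduct.

Section BoxProduct.
Variable X : topologicalType.

Lemma box_open (U : nat -> set X) : open_family U -> open (box U).
Proof.
move=> oU; exists [set U]; first by move=> _ ->.
by rewrite bigcup_set1.
Qed.

Lemma box_nbhs (A : set (box_product X)) (y : box_product X) :
  nbhs y A -> exists U, [/\ open_family U, box U y & box U `<=` A].
Proof.
rewrite nbhsE => -[_ [[D' D'o <-] [U D'U Uy]] DA].
by exists U; split=> //; [exact: D'o|move=> z Uz; apply: DA; exists U].
Qed.

End BoxProduct.

Section Transfer.
Variables (K : topologicalType) (W V : Type) (lt : W -> W -> Prop).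
Variables (p : bool -> K) (phi : V -> nat -> bool) (G : W -> W -> V).
Hypothesis K_T1 : accessible_space K.
Hypothesis p_inj : injective p.
Hypothesis phi_inj : injective phi.
Hypothesis G_closed : forall v : W -> V,
  (forall B, countable B -> exists c, forall b, B b -> G c b = v b) ->
  exists a, forall b, G a b = v b.
Hypothesis G_diag : forall a b, G a b = G b b -> ~ lt b a.
Hypothesis G_accumulation : forall E : set W,
  (forall b, exists2 a, E a & ~ lt a b) ->
  exists2 a, E a & forall B, countable B ->
    exists c, [/\ E c, lt c a & forall b, B b -> G c b = G a b].

(** A code in which every bit of [phi v] recurs infinitely often, so that each tail
    of it determines [v]. *)
Definition bits (v : V) (n : nat) : bool := phi v (logn 2 n).

Lemma bits_inj v w m : (forall n, (m <= n)%N -> bits v n = bits w n) -> v = w.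
Proof.
move=> vw; apply: phi_inj; apply/funext => i.
have logi : logn 2 (2 ^ i * m.*2.+1) = i.
  rewrite lognM ?expn_gt0 // pfactorK // lognE /= dvdn2 /= odd_double /=.
  by rewrite addn0.
have := vw (2 ^ i * m.*2.+1)%N; rewrite /bits logi; apply.
rewrite (leq_trans (n := m.*2.+1)) //; last by rewrite leq_pmull // expn_gt0.
by rewrite -addnn leqW // leq_addr.
Qed.

Definition point_of (a : W) : box_product {ptws W -> K} :=
  fun n b => p (bits (G a b) n).

(** A basic neighbourhood for the countable-support topology: the place [b k] is
    restricted in the factors from the [k]-th on, hence finitely many places in
    each factor.  Excluding the opposite bit is an open condition, and prescribes
    the bit for a point with values in the range of [p]. *)
Definition bit_box (x : nat -> nat -> bool) (b : nat -> W) :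
    set (box_product {ptws W -> K}) :=
  box (fun n => [set y : {ptws W -> K} | forall k, (k <= n)%N -> y (b k) <> p (~~ x n k)]).

Lemma bit_box_open x b : open (bit_box x b).
Proof.
apply: box_open => n.
have -> : [set y : {ptws W -> K} | forall k, (k <= n)%N -> y (b k) <> p (~~ x n k)] =
    ~` \bigcup_(k in `I_n.+1) [set y : {ptws W -> K} | y (b k) = p (~~ x n k)].
  apply/seteqP; split=> y h; first by move=> [k kn]; exact: h.
  by move=> k kn ybk; apply: h; exists k.
apply: closed_openC; apply: closed_bigcup; first exact: finite_II.
move=> k _; rewrite -openC.
exact: ptws_neq_open.
Qed.

Lemma point_of_bit_box a x b : bit_box x b (point_of a) ->
  forall n k, (k <= n)%N -> bits (G a (b k)) n = x n k.
Proof.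
move=> h n k kn; have := h n k kn; rewrite /point_of.
by case: bits; case: (x n k).
Qed.

Lemma bit_box_point_of a x b : (forall n k, (k <= n)%N -> bits (G a (b k)) n = x n k) ->
  bit_box x b (point_of a).
Proof. by move=> h n k kn /p_inj; rewrite h //; case: (x n k). Qed.

(** A limit [y] has values in the range of [p], one place of one factor at a time.
    Testing a single place in all factors shows that the bits of [y] there are the
    code of some [v b]; testing countably many places shows that [v] is
    approximated on countable sets, and [G_closed] applies. *)
Lemma points_closed : closed (range point_of).
Proof.
move=> y cy.
have nonempty : exists a : W, True.
  have [_ [[a _ _] _]] := cy setT filterT; by exists a.
have [w0 _] := nonempty.
have ybit n b : exists x : bool, y n b = p x.
  apply: contrapT => nyb.
  have nb : nbhs y (box (fun m => if m == n then
      [set z : {ptws W -> K} | z b <> p true] `&`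
      [set z : {ptws W -> K} | z b <> p false] else setT)).
    apply: open_nbhs_nbhs; split.
      apply: box_open => m; case: (m == n); last exact: openT.
      by apply: openI; exact: ptws_neq_open.
    move=> m; case: eqP => [->|//]; split=> h; apply: nyb; by eexists; exact: h.
  have [_ [[a _ <-] /(_ n)]] := cy _ nb; rewrite eqxx => -[].
  by rewrite /point_of /=; case: bits.
have [x xP] : exists x : nat -> W -> bool, forall n b, y n b = p (x n b).
  have [x xP] := choice (fun nb : nat * W => ybit nb.1 nb.2).
  by exists (fun n b => x (n, b)) => n b; exact: (xP (n, b)).
have approx (e : nat -> W) : exists c, forall n k,
    (k <= n)%N -> bits (G c (e k)) n = x n (e k).
  have nb : nbhs y (bit_box (fun n k => x n (e k)) e).
    apply: open_nbhs_nbhs; split; first exact: bit_box_open.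
    by move=> n k kn; rewrite xP => /p_inj; case: (x n (e k)).
  have [_ [[c _ <-] cb]] := cy _ nb.
  by exists c; exact: point_of_bit_box.
have vex b : exists v, forall n, bits v n = x n b.
  by have [c cP] := approx (fun=> b); exists (G c b) => n; exact: cP (leq0n n).
have [v vP] := choice vex.
have [a aP] : exists a, forall b, G a b = v b.
  apply: G_closed => B /(card_le_cover w0)[e Be]; have [c cP] := approx e.
  exists c => b /Be[k _ <-]; apply: (@bits_inj _ _ k) => n kn.
  by rewrite cP // vP.
exists a => //; apply/funext => n; apply/funext => b.
by rewrite /point_of aP vP xP.
Qed.

(** The neighbornet isolating the point [a] from later points, and missing all
    points elsewhere.  A kernel must contain unboundedly many of the points, and
    then it accumulates at one of them. *)
Theorem box_product_not_D : ~ D_space (box_product {ptws W -> K}).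
Proof.
pose nbox a := bit_box (fun n _ => bits (G a a) n) (fun=> a).
have nboxP a c : nbox a (point_of c) -> ~ lt a c.
  move=> /point_of_bit_box h; apply: G_diag.
  by apply: (@bits_inj _ _ 0%N) => n _; exact: h n 0%N (leq0n n).
have nbox_self a : nbox a (point_of a) by exact: bit_box_point_of.
have Uex y : exists A : set _,
    (exists2 a, y = point_of a & A = nbox a) \/
    (~ range point_of y /\ A = ~` range point_of).
  have [[a _ <-]|ny] := pselect (range point_of y).
    by exists (nbox a); left; exists a.
  by exists (~` range point_of); right.
have [U UP] := choice Uex.
move=> /(_ U)[|D [_ discD covD]].
  move=> y; case: (UP y) => [[a -> ->]|[ny ->]].
    by split; [exact: bit_box_open|exact: nbox_self].
  by split=> //; rewrite openC; exact: points_closed.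
have [|a Da acc] := G_accumulation (E := [set a | D (point_of a)]).
  move=> c; have : (\bigcup_(y in D) U y) (point_of c) by rewrite covD.
  move=> [y Dy]; case: (UP y) => [[a ya ->]|[_ ->]]; last by case; exists c.
  by move=> /nboxP ac; exists a => //=; rewrite -ya.
have [_ [N Na ND]] := discD _ Da.
have [A [oA Aa AN]] := box_nbhs Na.
have [B BP] := choice (fun n => ptws_open_countable (oA n) (Aa n)).
have [|c [Dc ca cP]] := acc (\bigcup_n B n).
  by apply: bigcup_countable => // n _; exact: (BP n).1.
have : (N `&` D) (point_of c).
  split=> //; apply: AN => n; apply: (BP n).2 => b Bb.
  by rewrite /point_of cP //; exists n.
rewrite ND => cae.
by apply: (nboxP c a _ ca); rewrite -cae; exact: nbox_self.
Qed.
End Transfer.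

(** * Enumerations from the cardinal arithmetic *)

Lemma card_eq_bij (S T : Type) : [set: S] #= [set: T] ->
  exists (f : S -> T) (g : T -> S), cancel f g /\ cancel g f.
Proof.
move=> /card_bijP[f [g fK gK]].
pose tos (U : Type) (u : U) : [set: U] := exist _ u (mem_set I).
have tosK U (z : [set: U]) : tos U (set_val z) = z by exact: val_inj.
exists (fun s => set_val (f (tos S s))), (fun t => set_val (g (tos T t))).
by split=> z; rewrite tosK (fK, gK).
Qed.

Definition interleave (z : (nat -> bool) * (nat -> bool)) : nat -> bool :=
  fun n => if odd n then z.2 n./2 else z.1 n./2.
Definition unleave (x : nat -> bool) : (nat -> bool) * (nat -> bool) :=
  (fun n => x n.*2, fun n => x n.*2.+1).

Lemma interleaveK : cancel interleave unleave.
Proof.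
case=> x y; congr pair; apply/funext => n; rewrite /interleave /=.
  by rewrite odd_double doubleK.
by rewrite odd_double /= uphalf_double.
Qed.

(** Bit 0 is the first component, bit 1 tells [None] from [Some], the rest is the
    code of the place. *)
Definition code_coord (S : Type) (u : S -> nat -> bool) (z : bool * option S)
    (n : nat) : bool :=
  match n, z.2 with
  | 0, _ => z.1
  | 1, o => isSome o
  | m.+2, Some s => u s m
  | m.+2, None => false
  end.

Lemma code_coord_inj (S : Type) (u : S -> nat -> bool) :
  injective u -> injective (code_coord u).
Proof.
move=> u_inj [x o] [y o'] e.
have := congr1 (fun f => f 0%N) e; rewrite /= => ->.
have := congr1 (fun f => f 1%N) e.
case: o o' e => [s|] [t|] //= e _; congr (_, Some _); apply: u_inj.
by apply/funext => n; exact: (congr1 (fun f => f n.+2) e).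
Qed.

Lemma first_difference (S T : Type) (lt : S -> S -> Prop) (r : T -> S -> bool) :
  well_founded lt -> injective r ->
  forall a b, a <> b -> exists i, r a i <> r b i /\ agree lt r a b i.
Proof.
move=> wf r_inj a b ab.
have [i ni] : exists i, r a i <> r b i.
  apply: contrapT => h; apply/ab/r_inj/funext => i.
  by apply: contrapT => ni; apply: h; exists i.
elim: (wf i) ni => {}i _ IH ni.
have [h|] := pselect (agree lt r a b i); first by exists i.
by move=> /existsNP[j /not_implyP[ji nj]]; exact: (IH j ji nj).
Qed.

Section Line.
Variables S T : Type.
Hypothesis nat_S : succ_card nat S.
Hypothesis ST : succ_card S T.
Hypothesis CH : [set: nat -> bool] #= [set: S].
Hypothesis CH1 : [set: S -> bool] #= [set: T].

(** CH provides the pairings of [S] needed for regularity of [T] and for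
    enumerating the nodes of the tree; the second hypothesis enumerates both the
    points of 2^S and, through the pairing, all maps from [S] to [T] by [T]. *)
Lemma line_exists : exists (lt : T -> T -> Prop) (phi : bool * option S -> nat -> bool)
    (G : T -> T -> bool * option S),
  [/\ injective phi,
    forall v : T -> bool * option S,
      (forall B, countable B -> exists c, forall b, B b -> G c b = v b) ->
      exists a, forall b, G a b = v b,
    forall a b, G a b = G b b -> ~ lt b a &
    forall E : set T, (forall b, exists2 a, E a & ~ lt a b) ->
      exists2 a, E a & forall B, countable B ->
        exists c, [/\ E c, lt c a & forall b, B b -> G c b = G a b]].
Proof.
have [lt1 ord1] := succ_card_initial_order nat_S.
have [lt2 ord2] := succ_card_initial_order ST.
have [u' [u [u'K uK]]] := card_eq_bij CH.
have [j [r [jK rK]]] := card_eq_bij CH1.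
pose s0 := u' (fun=> true); pose t0 := j (fun=> true).
pose enc z := u' (interleave z).
have encK z : unleave (u (enc z)) = z by rewrite /enc u'K interleaveK.
pose p i := let z := unleave (u i) in
  (u' z.1, if z.2 0%N then Some (u' (fun n => z.2 n.+1)) else None).
have p_surj z : exists i, p i = z.
  case: z => i [k|].
    exists (enc (u i, fun n => if n is m.+1 then u k m else true)).
    by rewrite /p encK /= !uK.
  by exists (enc (u i, fun=> false)); rewrite /p encK /= !uK.
pose q i := let z := unleave (u i) in (u' z.1, z.2).
have q_surj z : exists i, q i = z.
  by case: z => i x; exists (enc (u i, x)); rewrite /q encK /= uK.
(* A map from [S] to [T] is a map from S * S to [bool], hence a member of [T]. *)
pose fam n i := j (fun k => r n (enc (u i, u k))).
have fam_surj A : exists n, fam n = A.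
  exists (j (fun w => let z := unleave (u w) in r (A (u' z.1)) (u' z.2))).
  apply/funext => i; rewrite /fam -[RHS]rK; congr j; apply/funext => k.
  by rewrite jK encK /= !uK.
have bounded1 (f : nat -> S) : exists i, forall k, lt1 (f k) i.
  pose pn n : nat * option nat := odflt (0%N, None) (unpickle n).
  apply: (succ_card_bounded (p := pn)) => // z.
  by exists (pickle z); rewrite /pn pickleK.
have bounded2 (f : S -> T) : exists b, forall i, lt2 (f i) b.
  exact: (succ_card_bounded (p := p)).
have [pr prP] : exists pr : T -> S, [set: S] `<=` range pr.
  by case: ST => h _ _; exact: card_le_cover s0 h.
have [sec secK] : exists sec : S -> T, cancel sec pr.
  have ex i : exists t, pr t = i by have [t _ <-] := prP i I; exists t.
  by have [sec secP] := choice ex; exists sec.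
have r_inj : injective r := can_inj rK.
have r_surj x : exists a, r a = x by exists (j x).
have [diff diffP] : exists diff : T -> T -> S, forall a b, a <> b ->
    r a (diff a b) <> r b (diff a b) /\ agree lt1 r a b (diff a b).
  have ex (z : T * T) : exists i, z.1 <> z.2 ->
      r z.1 i <> r z.2 i /\ agree lt1 r z.1 z.2 i.
    have [e|ne] := pselect (z.1 = z.2); first by exists s0.
    case: ord1 => wf _ _ _.
    by have [i] := first_difference wf r_inj ne; exists i.
  have [d dP] := choice ex.
  by exists (fun a b => d (a, b)) => a b; exact: (dP (a, b)).
have [seg segP] : exists seg : T -> S -> T, forall b, [set a | lt2 a b] `<=` range (seg b).
  case: ord2 => _ _ _ small.
  by have [seg segP] := choice (fun b => card_le_cover b (small b)); exists seg.
pose cand := candidate lt1 lt2 r fam.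
have [pick pickP] : exists pick : T -> T -> S -> T, forall b n i,
    cand b n i !=set0 -> cand b n i (pick b n i).
  have ex (z : T * T * S) : exists s, cand z.1.1 z.1.2 z.2 !=set0 ->
      cand z.1.1 z.1.2 z.2 s.
    have [[s cs]|nc] := pselect (cand z.1.1 z.1.2 z.2 !=set0); first by exists s.
    by exists t0.
  have [d dP] := choice ex.
  by exists (fun b n i => d (b, n, i)) => b n i; exact: (dP (b, n, i)).
exists lt2, (code_coord u),
  (line_coord lt1 lt2 r fam pr diff seg pick); split.
- exact: code_coord_inj (can_inj uK).
- exact: (line_closed ord1 ord2 bounded1 r_surj secK diffP).
- exact: (line_coord_diag ord2).
- exact: (line_accumulation ord1 ord2 bounded1 bounded2 fam_surj q_surj _
    diffP segP pickP t0).
Qed.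
End Line.

(** * The box product of cubes *)

Unset Implicit Arguments.
Theorem mainTheorem2 (R : realType) (omega1 omega2 : Type)
  (homega1 : succ_card nat omega1)
  (homega2 : succ_card omega1 omega2)
  (CH : [set: nat -> bool] #= [set: omega1])
  (CH1 : [set: omega1 -> bool] #= [set: omega2]) :
  ~ D_space (box_product {ptws omega2 -> `[0, 1]%classic : set R}).
Proof.
have [lt [phi [G [phi_inj Gcl Gdiag Gacc]]]] := line_exists homega1 homega2 CH CH1.
have I0 : (0 : R) \in `[0, 1]%classic by rewrite inE /= in_itv /= lexx ler01.
have I1 : (1 : R) \in `[0, 1]%classic by rewrite inE /= in_itv /= lexx ler01.
pose p (b : bool) : `[0, 1]%classic : set R := if b then SigSub I1 else SigSub I0.
apply: (@box_product_not_D _ _ _ lt p phi G) => //.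
- apply: hausdorff_accessible => x y xy.
  apply: val_inj; apply: (@Rhausdorff R) => A B nA nB.
  have vc : continuous (set_val : (`[0, 1]%classic : set R) -> R).
    exact: initial_continuous.
  by have [z [Az Bz]] := xy _ _ (vc x A nA) (vc y B nB); exists (set_val z).
- by move=> [] [] // /(congr1 val) /eqP; rewrite /= ?oner_eq0 // eq_sym oner_eq0.
Qed.
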